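(* Let $k$ be a field, $S=k[x_1,\ldots,x_n]$, $d\ge 2$ an integer, and $u\ge_{lex}v$ monomials of degree $d$. Let $I=(\mathcal L(u,v))$ be a completely lexsegment ideal which has linear quotients with respect to the ordering $\prec$ of its generators, and let $g:M(I)\to G(I)$ be the decomposition function of $I$ with respect to the ordering $\prec$. If $w\in\mathcal L(u,v)$ and $s\in\mathrm{set}(w)$, then $$g(x_sw)=\begin{cases}\dfrac{x_sw}{x_1}, & \text{if } x_sw\ge_{lex}x_1v,\\[2mm] \dfrac{x_sw}{x_{\max(w)}}, & \text{if } x_sw<_{lex}x_1v.\end{cases}$$
   Context: Lexicographic order is taken with $x_1>\cdots>x_n$. $\mathcal M_d$ is the set of monomials of degree $d$ of $S$ and $\mathcal L(u,v)=\{w\in\mathcal M_d: u\ge_{lex}w\ge_{lex}v\}$ is the lexsegment determined by $u,v$. The shadow of a set $\mathcal L$ of monomials is $\mathrm{Shad}(\mathcal L)=\{x_iw: w\in\mathcal L,\ 1\le i\le n\}$; the ideal $(\mathcal L(u,v))$ is a completely lexsegment ideal if all iterated shadows of $\mathcal L(u,v)$ are lexsegments. The total order $\prec$ on $\mathcal M_d$ is: for $w=x_1^{\alpha_1}\cdots x_n^{\alpha_n}$ and $w'=x_1^{\beta_1}\cdots x_n^{\beta_n}$, $w\prec w'$ if $\alpha_1<\beta_1$, or $\alpha_1=\beta_1$ and $w>_{lex}w'$. Write $\mathcal L(u,v)=\{w_1,\ldots,w_r\}$ with $w_1\prec\cdots\prec w_r$; $I$ has linear quotients with respect to $\prec$ if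 for all $i\ge 2$ the ideal $(w_1,\ldots,w_{i-1}):w_i$ is generated by variables. $\mathrm{set}(w_i)=\{j\in\{1,\ldots,n\}: x_j\in(w_1,\ldots,w_{i-1}):w_i\}$. $M(I)$ is the set of all monomials in $I$, $G(I)=\mathcal L(u,v)$ is the minimal monomial generating set, and the decomposition function is $g(m)=w_j$, where $j$ is the smallest index with $m\in(w_1,\ldots,w_j)$. For a monomial $w$, $\max(w)=\max\{j: x_j\mid w\}$. *)

(* Defs.v *)
From HB Require Import structures.
From mathcomp Require Import all_boot all_order all_algebra.
From mathcomp Require Import mpoly.

Set Implicit Arguments.
Unset Strict Implicit.
Unset Printing Implicit Defensive.

Import Order.TTheory GRing.Theory.

Local Open Scope ring_scope.

(* k[x_1, ..., x_N] with N >= 1 is {mpoly k[n.+1]} with N = n.+1; the variables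
   are numbered from 0, so x_1 is 'X_ord0. Monomials are exponent vectors in
   'X_{1..n.+1}: in multi_scope (%MM) their product is +, their quotient is -,
   divisibility is <= and the variable of index i is U_(i). *)

Section IdealOps.
Variable R : comNzRingType.

Definition ideal_gen (G : R -> Prop) (p : R) : Prop :=
  exists s : seq (R * R),
    (forall c, c \in s -> G c.2) /\ p = \sum_(c <- s) c.1 * c.2.

Definition colon (J : R -> Prop) (q p : R) : Prop := J (p * q).

End IdealOps.

Section Monomials.
Variable n : nat.
Implicit Types (m w u v : 'X_{1..n.+1}) (L : 'X_{1..n.+1} -> Prop).

(* Pure lexicographic order with x_1 > ... > x_n. The canonical order on
   'X_{1..n} compares total degrees first, hence the explicit alias. *)
Definition lex_le m1 m2 : bool :=
  ((m1 : seq nat) <= (m2 : seq nat) :> seqlexi nat)%O.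
Definition lex_lt m1 m2 : bool :=
  ((m1 : seq nat) < (m2 : seq nat) :> seqlexi nat)%O.

Definition lexseg (d : nat) u v : pred 'X_{1..n.+1} :=
  fun w => [&& mdeg w == d, lex_le w u & lex_le v w].

Definition is_lexseg L : Prop :=
  exists (d : nat) u v,
    [/\ mdeg u = d, mdeg v = d, lex_le v u & forall w, L w <-> lexseg d u v w].

Definition shadow L : 'X_{1..n.+1} -> Prop :=
  fun m => exists w (i : 'I_n.+1), L w /\ m = (U_(i) + w)%MM.

Definition completely_lexseg L : Prop :=
  forall t : nat, is_lexseg (iter t shadow L).

Definition prec w w' : bool :=
  (w ord0 < w' ord0)%N || (w ord0 == w' ord0) && lex_lt w' w.

(* ws = [:: w_1; ...; w_r] lists L(u, v) increasingly for prec, and is thus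
   uniquely determined; w_(i+1) is nth 0%MM ws i. *)
Definition prec_enum (d : nat) u v (ws : seq 'X_{1..n.+1}) : Prop :=
  sorted prec ws /\ (forall w, (w \in ws) = lexseg d u v w).

Definition max_var w : 'I_n.+1 := inord (\max_(j < n.+1 | (U_(j) <= w)%MM) j).

End Monomials.

Section Quotients.
Variables (n : nat) (k : fieldType).
Implicit Types (m w : 'X_{1..n.+1}) (ws : seq 'X_{1..n.+1}).

Definition mon_ideal ws : {mpoly k[n.+1]} -> Prop :=
  ideal_gen (fun p => exists2 w, w \in ws & p = 'X_[w]).

Definition generated_by_variables (J : {mpoly k[n.+1]} -> Prop) : Prop :=
  exists A : {set 'I_n.+1},
    forall p, J p <-> ideal_gen (fun q => exists2 j, j \in A & q = 'X_j) p.

(* The colon ideal (w' : w' before w in ws) : w. *)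
Definition colon_before ws w : {mpoly k[n.+1]} -> Prop :=
  colon (mon_ideal (take (index w ws) ws)) 'X_[w].

Definition linear_quotients ws : Prop :=
  forall i : nat, (0 < i < size ws)%N ->
    generated_by_variables (colon_before ws (nth 0%MM ws i)).

Definition lq_set ws w (s : 'I_n.+1) : Prop := colon_before ws w 'X_s.

(* The values of g outside M(I) are left unconstrained. *)
Definition decomposition_function ws (g : 'X_{1..n.+1} -> 'X_{1..n.+1})
    : Prop :=
  forall m, mon_ideal ws 'X_[m] ->
    exists j : nat,
      [/\ (j < size ws)%N, g m = nth 0%MM ws j,
          mon_ideal (take j.+1 ws) 'X_[m]
        & forall i : nat, (i < j)%N -> ~ mon_ideal (take i.+1 ws) 'X_[m]].

End Quotients.

(* Main.v *)
Require Import Defs.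
From HB Require Import structures.
From mathcomp Require Import all_boot all_order all_algebra.
From mathcomp Require Import mpoly.
From mathcomp Require Import zify.

(* Since [x_s w] has degree [d + 1], its divisors in the lexsegment are quotients
   [x_s w / x_i], and removing [x_1] beats removing any other variable for
   [prec], while among the others the last one wins. So everything reduces to
   [x_s w / x_max(w) <= u] when [x_s w < x_1 v]; this can only fail if [u] and
   [w] have the same [x_1]-exponent [a], and the [x_1]-exponent of [v] is [a] or
   [a - 1].

   If it is [a], the monomial [x_1^a x_2^(d+1-a)] of the shadow forces
   [x_1^a x_2^(d-a)] into the lexsegment.

   If it is [a - 1], put [y = u / x_1] and [z = x_s w / (x_1 x_max(w))], so that
   [y < z] although [z x_max(w) < v]. At the first variable [x_t] where [y] and
   [v] differ, let [p] be the part of [y] in [x_1, ..., x_t]. Linear quotients fail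
   at [x_1 p x_n^k] against [p x_t^(k+1)], with [k] such that the degrees are [d],
   unless [v = p x_t x_n^k]. In that case [y < p x_(t+1)^k], and linear quotients
   fail at [x_1 (p / x_c) x_(t+1)^(k+1)] against [(p / x_c) x_c^(k+2)], where [x_c]
   is the last variable of [p] other than [x_1]; if there is none, then
   [x_1 p x_(t+1)^(k+1)] is missing from the shadow. *)

Set Implicit Arguments.
Unset Strict Implicit.
Unset Printing Implicit Defensive.

Import Order.TTheory GRing.Theory.

(** * Divisibility and degree of monomials *)

Section Multinomials.
Variable n : nat.
Implicit Types (a b m : 'X_{1..n}) (i j : 'I_n).

Lemma mnm1_nat i j : U_(i)%MM j = ((i : nat) == j).
Proof. by rewrite mnm1E. Qed.

Lemma lepm_mnm1 m i : (U_(i) <= m)%MM = (0 < m i)%N.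
Proof.
apply/mnm_lepP/idP => [/(_ i)|m_i j]; rewrite mnm1_nat ?eqxx //.
by case: eqP => // /val_inj <-.
Qed.

Lemma lepm_mdeg a b : (a <= b)%MM -> (mdeg a <= mdeg b)%N.
Proof. by move=> le_ab; rewrite -(submK le_ab) mdegD leq_addl. Qed.

Lemma lepm_mdeg_eq a b : (a <= b)%MM -> mdeg a = mdeg b -> a = b.
Proof.
move=> le_ab eq_deg; have def_b := submK le_ab.
have /eqP := congr1 (@mdeg n) def_b; rewrite mdegD eq_deg -{2}[mdeg b]add0n.
by rewrite eqn_add2r mdeg_eq0 => /eqP ba0; rewrite -def_b ba0 add0m.
Qed.

Lemma lepm_mdegS a m : (a <= m)%MM -> mdeg m = (mdeg a).+1 ->
  exists2 i, (0 < m i)%N & a = (m - U_(i))%MM.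
Proof.
move=> le_am deg_m; have def_m := submK le_am.
have /eqP := congr1 (@mdeg n) def_m; rewrite mdegD deg_m -add1n eqn_add2r.
case/mdeg1P => i /eqP ma; exists i; rewrite -def_m ma.
  by rewrite mnmDE mnm1E eqxx.
by rewrite addmC addmK.
Qed.

End Multinomials.

(** * The lexicographic order and its extremal monomials with a given beginning *)

Section LexOrder.
Variable n : nat.
Implicit Types (a b m : 'X_{1..n.+1}) (i j t : 'I_n.+1).

Lemma lex_ltP a b :
  reflect (exists2 i : 'I_n.+1, 
             forall j : 'I_n.+1, (j < i)%N -> a j = b j & (a i < b i)%N)
          (lex_lt a b).
Proof.
apply: (iffP (@ltxi_tuplePlt _
  (Order.seqlexi_display Order.NatOrder.nat_display) _ _ a b));
  by move=> -[i eq_ab lt_ab]; exists i.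
Qed.

Lemma lex_leNgt a b : lex_le a b = ~~ lex_lt b a.
Proof. exact: leNgt. Qed.

Lemma lex_lexx a : lex_le a a. Proof. exact: lexx. Qed.

Lemma lex_ltxx a : lex_lt a a = false. Proof. exact: ltxx. Qed.

Lemma lex_le_trans a b c : lex_le a b -> lex_le b c -> lex_le a c.
Proof. exact: le_trans. Qed.

Lemma lex_lt_trans a b c : lex_lt a b -> lex_lt b c -> lex_lt a c.
Proof. exact: lt_trans. Qed.

Lemma lex_lt_le_trans a b c : lex_lt a b -> lex_le b c -> lex_lt a c.
Proof. exact: lt_le_trans. Qed.

Lemma lex_le_lt_trans a b c : lex_le a b -> lex_lt b c -> lex_lt a c.
Proof. exact: le_lt_trans. Qed.

Lemma lex_ltW a b : lex_lt a b -> lex_le a b. Proof. exact: ltW. Qed.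

Lemma lex_le_eqVlt a b : lex_le a b -> a = b \/ lex_lt a b.
Proof.
rewrite /lex_le le_eqVlt => /orP[/eqP eq_ab|]; [left|by right].
by apply/mnmP => i; rewrite !(mnm_nth 0) eq_ab.
Qed.

Lemma lex_lt_add2r m a b : lex_lt (a + m)%MM (b + m)%MM = lex_lt a b.
Proof.
by apply/lex_ltP/lex_ltP => -[i eq_ab lt_ab]; exists i => [j /eq_ab|];
  move: lt_ab; rewrite !mnmDE; lia.
Qed.

Lemma lex_le_add2r m a b : lex_le (a + m)%MM (b + m)%MM = lex_le a b.
Proof. by rewrite !lex_leNgt lex_lt_add2r. Qed.

Lemma lex_lt0 a b : (a ord0 < b ord0)%N -> lex_lt a b.
Proof. by move=> lt0; apply/lex_ltP; exists ord0. Qed.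

Lemma lex_le0 a b : lex_le a b -> (a ord0 <= b ord0)%N.
Proof. by apply: contraLR; rewrite lex_leNgt negbK -ltnNge; apply: lex_lt0. Qed.

Lemma lex_le_addr a m : lex_le a (a + m)%MM.
Proof.
rewrite lex_leNgt; apply/negP => /lex_ltP[i _]; rewrite mnmDE.
by rewrite ltnNge leq_addr.
Qed.

Lemma lex_mnm1 i j : lex_lt U_(i)%MM U_(j)%MM = (j < i)%N.
Proof.
apply/lex_ltP/idP => [[k /(_ i)]|lt_ji].
  by rewrite !mnm1_nat; lia.
by exists j => [l|]; rewrite !mnm1_nat; lia.
Qed.

(** At a first index [c] where [a] is smaller, [c >= t], so [a] vanishes past [c] and divides [b];
    equal degrees then force [a = b]. *)
Lemma lex_max (t : nat) a b : mdeg a = mdeg b ->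
    (forall i, (i < t)%N -> a i = b i) -> (forall i, (t < i)%N -> a i = 0%N) ->
  lex_le b a.
Proof.
move=> eq_deg eq_ab a0; rewrite lex_leNgt; apply/negP => lt_ab.
suff eq_ab' : a = b by rewrite eq_ab' lex_ltxx in lt_ab.
case/lex_ltP: lt_ab => c eq_c lt_c; apply: lepm_mdeg_eq => //.
apply/mnm_lepP => i; have [/eq_c->//|] := ltnP i c.
rewrite leq_eqVlt => /orP[/val_eqP <-|lt_ci]; first exact: ltnW.
rewrite a0 // (leq_ltn_trans _ lt_ci) // leqNgt.
by apply/negP => /eq_ab eq_abc; rewrite eq_abc ltnn in lt_c.
Qed.

(** Dually, the remaining degree sits on the last variable, of index [n]: a first index where [b] is
    smaller has a positive exponent in [a], hence is [n] itself. *)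
Lemma lex_min (t : nat) a b : mdeg a = mdeg b ->
    (forall i, (i < t)%N -> a i = b i) ->
    (forall i, (t <= i < n)%N -> a i = 0%N) ->
  lex_le a b.
Proof.
move=> eq_deg eq_ab a0; rewrite lex_leNgt; apply/negP => lt_ba.
suff eq_ab' : b = a by rewrite eq_ab' lex_ltxx in lt_ba.
case/lex_ltP: lt_ba => c eq_c lt_c; apply: lepm_mdeg_eq => //.
have le_tc : (t <= c)%N.
  by rewrite leqNgt; apply/negP => /eq_ab eq_abc; rewrite eq_abc ltnn in lt_c.
have eq_cn : c = n :> nat.
  by have := ltn_ord c; have := @a0 c; lia.
apply/mnm_lepP => i; have [/eq_c->//|le_ci] := ltnP i c.
have -> : i = c by apply: val_inj => /=; have := ltn_ord i; lia.
exact: ltnW.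
Qed.

End LexOrder.

(** * Membership of monomials in monomial ideals *)

Section MonomialIdeals.
Variables (n : nat) (k : fieldType).
Implicit Types m w : 'X_{1..n}.
Local Open Scope ring_scope.

(** Some summand of the combination has a nonzero coefficient at [m], and all monomials of a
    multiple of ['X_[w]] are divisible by [w]. *)
Lemma mem_monomial_ideal (P : 'X_{1..n} -> Prop) m :
  ideal_gen (fun p : {mpoly k[n]} => exists2 w, P w & p = 'X_[w]) 'X_[m] <->
  exists2 w, P w & (w <= m)%MM.
Proof.
split=> [[s [gen_s def_m]]|[w Pw le_wm]]; last first.
  exists [:: ('X_[m - w], 'X_[w])]; split=> [c|].
    by rewrite inE => /eqP ->; exists w.
  by rewrite big_seq1 -mpolyXD submK.
have [c cs] : exists2 c, c \in s & (c.1 * c.2)@_m != 0.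
  apply/hasP; rewrite -[has _ _]negbK -all_predC; apply/negP => /allP s0.
  have /eqP := congr1 (mcoeff m) def_m; rewrite mcoeffX eqxx raddf_sum big_seq.
  by rewrite big1 ?oner_eq0 // => c /s0 /=; rewrite negbK => /eqP.
case: (gen_s c cs) => w Pw ->; rewrite mcoeff_eq0 negbK (perm_mem (msuppMX _ _)).
by case/mapP => m' _ ->; exists w => //; apply: lem_addr.
Qed.

End MonomialIdeals.

(* [lia] alone gets lost preprocessing the order hypotheses on monomials. *)
Ltac exponent_lia :=
  repeat match goal with
  | H : context [lex_le _ _] |- _ => clear H
  | H : context [lex_lt _ _] |- _ => clear H
  | H : context [prec _ _] |- _ => clear H
  | H : context [lexseg _ _ _] |- _ => clear H
  | H : is_true (_ <= _)%MM |- _ => clear H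
  end; lia.

(** * The exchange property and an obstruction to it *)

Section Lexsegments.
Variables (n d : nat) (u v : 'X_{1..n.+1}).
Implicit Types (m w p z : 'X_{1..n.+1}) (i j t e : 'I_n.+1).
Local Notation L := (lexseg d u v).

Lemma lexsegP w : reflect [/\ mdeg w = d, lex_le w u & lex_le v w] (L w).
Proof. by apply: (iffP and3P) => -[/eqP]. Qed.

Lemma prec_irr w : prec w w = false.
Proof. by rewrite /prec ltnn eqxx lex_ltxx. Qed.

(* Linear quotients with respect to [prec], read off on exponents. *)
Definition exchange : Prop := forall w r, L w -> L r -> prec r w ->
  exists i w', [/\ (w i < r i)%N, L w', prec w' w & (w' <= U_(i) + w)%MM].

(** Exchange [x_1 p x_e^k] against [p x_t^(k+1)]. The new generator is [x_t x_1 p x_e^k / x_j]: for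
    [x_j = x_1] it lies below [v], for [x_j = x_e] above [u], and [prec] excludes the other
    [x_j]. *)
Lemma exchange_obstruction t e p k :
    exchange -> u ord0 = (v ord0).+1 ->
    (0 < t)%N -> (t < e)%N -> (forall i, (t < i)%N -> p i = 0%N) ->
    p ord0 = v ord0 -> (mdeg p + k).+1 = d ->
    lex_le v (p + U_(t) *+ k.+1)%MM ->
    lex_lt (U_(t) + (p + U_(e) *+ k))%MM v ->
    lex_le (U_(ord0) + (p + U_(e) *+ k))%MM u ->
  ~ ((0 < k)%N -> lex_lt u (U_(ord0) + (U_(t) + (p + U_(e) *+ k.-1)))%MM).
Proof.
move=> hex u0 t_gt0 lt_te p_gt p0 deg_p le_vr lt_v le_u lt_u.
(* For [k = 0] the two bounds involving [v] clash on the same monomial [p x_t]. *)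
have k_gt0 : (0 < k)%N.
  rewrite lt0n; apply/eqP => k0; move: le_vr lt_v.
  by rewrite k0 mulm0n addm0 mulm1n addmC lex_leNgt => /negP.
set q := (p + U_(e) *+ k)%MM in lt_v le_u.
have q0 : q ord0 = v ord0 by rewrite mnmDE mulmnE mnm1_nat p0 /=; case: eqP; exponent_lia.
have Lw : L (U_(ord0) + q)%MM.
  apply/lexsegP; split=> //; first by rewrite !mdegD mdegMn !mdeg1 -deg_p; exponent_lia.
  by apply/lex_ltW/lex_lt0; rewrite mnmDE mnm1_nat q0.
have r0 : (p + U_(t) *+ k.+1)%MM ord0 = v ord0.
  by rewrite mnmDE mulmnE mnm1_nat p0 /=; case: eqP; exponent_lia.
have Lr : L (p + U_(t) *+ k.+1)%MM.
  apply/lexsegP; split=> //; first by rewrite !mdegD mdegMn !mdeg1 -deg_p; exponent_lia.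
  by apply/lex_ltW/lex_lt0; rewrite r0 u0.
have pr : prec (p + U_(t) *+ k.+1)%MM (U_(ord0) + q)%MM.
  by rewrite /prec r0 mnmDE mnm1_nat q0 ltnSn.
have [i [w' [lt_i Lw' pw' le_w']]] := hex _ _ Lw Lr pr.
have {lt_i} def_i : i = t.
  apply: val_inj; move: lt_i; rewrite !mnmDE !mulmnE !mnm1_nat /=.
  by case: (eqVneq (t : nat) i) => //; exponent_lia.
rewrite {}def_i in le_w'.
have [deg_w' le_w'u le_vw'] := lexsegP _ Lw'.
have [j j_gt0 def_w'] : exists2 j, (0 < (U_(t) + (U_(ord0) + q))%MM j)%N &
    w' = (U_(t) + (U_(ord0) + q) - U_(j))%MM.
  apply: lepm_mdegS => //; rewrite deg_w'.
  by rewrite !mdegD mdegMn !mdeg1 -deg_p mul1n.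
have [j0|j_neq0] := eqVneq j ord0.
  move: le_vw'; rewrite def_w' j0 addmA [(U_(t) + _)%MM]addmC.
  by rewrite -addmA addmC addmK lex_leNgt lt_v.
have w'0 : w' ord0 = (U_(ord0) + q)%MM ord0.
  have := t_gt0; have : (j : nat) != 0%N by [].
  by rewrite def_w' mnmBE mnmDE !mnm1_nat /=; exponent_lia.
have def_w'j : (w' + U_(j) = U_(t) + (U_(ord0) + q))%MM.
  by rewrite def_w' submK //; apply/mnm_lepP => l; rewrite mnm1_nat;
    case: eqP => // /val_inj <-.
(* At equal [x_1]-exponents [prec] prefers the lexicographically larger monomial, so the removed
   variable comes after [x_t]; there only [x_e] occurs. *)
have lt_tj : (t < j)%N.
  move: pw'; rewrite /prec w'0 ltnn eqxx /= -(lex_lt_add2r U_(j)%MM) def_w'j.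
  by rewrite addmC lex_lt_add2r lex_mnm1.
have j_e : j = e.
  apply: val_inj; move: j_gt0; have := p_gt _ lt_tj; have : (j : nat) != 0%N by [].
  rewrite !mnmDE mulmnE !mnm1_nat /=; case: (eqVneq (e : nat) j) => //; exponent_lia.
have {}lt_u := lt_u k_gt0; move: le_w'u; rewrite lex_leNgt.
suff -> : w' = (U_(ord0) + (U_(t) + (p + U_(e) *+ k.-1)))%MM by rewrite lt_u.
apply/mnmP => l; rewrite def_w' j_e /q !(mnmBE, mnmDE, mulmnE, mnm1_nat).
by case: eqP; case: eqP; case: eqP; exponent_lia.
Qed.

End Lexsegments.

(** * Bounds by [u] when the shadow is a lexsegment *)

Section CompletelyLexsegment.
Variables (n d : nat) (u v : 'X_{1..n.+1}).
Hypotheses (deg_u : mdeg u = d) (deg_v : mdeg v = d) (le_vu : lex_le v u).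
Hypothesis shad_seg : is_lexseg (shadow (fun w => lexseg d u v w)).
Implicit Types (m w p z : 'X_{1..n.+1}) (i j t e : 'I_n.+1).

(** The shadow contains [x_1 u] and the product of [v] with the last variable; a lexsegment contains
    whatever lies between two of its elements. *)
Lemma shadow_between m : mdeg m = d.+1 ->
    lex_le (U_(ord_max) + v)%MM m -> lex_le m (U_(ord0) + u)%MM ->
  exists i w, lexseg d u v w /\ m = (U_(i) + w)%MM.
Proof.
move=> deg_m le_vm le_mu; case: shad_seg => d' [u' [v' [deg_u' deg_v' le_v'u' segP]]].
have seg w i : lexseg d u v w -> lexseg d' u' v' (U_(i) + w)%MM.
  by move=> Lw; apply/segP; exists w, i.
have /lexsegP[deg_d' le_uu' _] := seg u ord0
  (introT (lexsegP _ _ _ _) (And3 deg_u (lex_lexx u) le_vu)).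
have /lexsegP[_ _ le_v'v] := seg v ord_max
  (introT (lexsegP _ _ _ _) (And3 deg_v le_vu (lex_lexx v))).
have /segP[w [i [Lw def_m]]] : lexseg d' u' v' m; last by exists i, w.
apply/lexsegP; split; first by rewrite deg_m -deg_d' mdegD mdeg1 deg_u.
  exact: lex_le_trans le_uu'.
exact: lex_le_trans le_vm.
Qed.

(** With [a] the common [x_1]-exponent, a generator dividing [x_1^a x_2^(d+1-a)] is at least [v], so
    it keeps [x_1^a] and is [x_1^a x_2^(d-a)], the largest monomial of degree [d] with this
    [x_1]-exponent. *)
Lemma shadow_bound z : u ord0 = v ord0 -> (0 < n)%N ->
  mdeg z = d -> z ord0 = u ord0 -> lex_le z u.
Proof.
move=> u0 n_gt0 deg_z z0.
pose y (e : nat) : 'X_{1..n.+1} :=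
  (U_(ord0) *+ u ord0 + U_(inord 1) *+ e)%MM.
have le_u0 : (u ord0 <= d)%N by rewrite -deg_u mdegE (bigD1 ord0) //= leq_addr.
have y_deg (e : nat) : mdeg (y e) = (u ord0 + e)%N.
  by rewrite !mdegD !mdegMn !mdeg1 !mul1n.
have y0 (e : nat) : y e ord0 = u ord0.
  by rewrite mnmDE !mulmnE !mnm1_nat inordK ?mul0n ?mul1n ?addn0.
have y_max (e : nat) b : mdeg b = (u ord0 + e)%N -> b ord0 = u ord0 -> lex_le b (y e).
  move=> deg_b b0; apply: (@lex_max _ 1); first by rewrite y_deg deg_b.
    by move=> i; rewrite ltnS leqn0 => /eqP/(@val_inj _ _ _ i ord0) ->; rewrite y0.
  move=> i lt_1i; rewrite mnmDE !mulmnE !mnm1_nat inordK //=.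
  by case: eqP => [|_]; [exponent_lia|case: eqP; exponent_lia].
have [|||i [w [/lexsegP[deg_w le_wu le_vw] def_w]]] :=
    @shadow_between (y (d - u ord0).+1).
- by rewrite y_deg; exponent_lia.
- apply: y_max; first by rewrite mdegD mdeg1 deg_v; exponent_lia.
  by rewrite mnmDE mnm1_nat u0 /=; case: eqP; exponent_lia.
- by apply/lex_ltW/lex_lt0; rewrite y0 mnmDE mnm1_nat.
have w0 : w ord0 = u ord0.
  have := congr1 (fun m : 'X_{1..n.+1} => m ord0) def_w.
  rewrite y0 mnmDE mnm1_nat; have := lex_le0 le_vw; rewrite -u0.
  by case: eqP; exponent_lia.
have i_neq0 : (i : nat) != 0%N.
  apply/eqP => /(@val_inj _ _ _ i ord0) i0.
  have := congr1 (fun m : 'X_{1..n.+1} => m ord0) def_w.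
  by rewrite y0 mnmDE mnm1_nat w0 i0 /=; exponent_lia.
have i1 : i = inord 1.
  have := congr1 (fun m : 'X_{1..n.+1} => m i) def_w.
  rewrite !mnmDE !mulmnE !mnm1_nat inordK // eqxx => def_wi.
  apply: val_inj; rewrite /= inordK //; move: def_wi => /=.
  by case: eqP; case: eqP; exponent_lia.
have def_wy : w = y (d - u ord0)%N.
  apply: (@addmI _ U_(i)%MM); rewrite -def_w i1.
  by apply/mnmP => l; rewrite !(mnmDE, mulmnE); exponent_lia.
apply: lex_le_trans le_wu; rewrite def_wy.
by apply: y_max; rewrite ?deg_z //; exponent_lia.
Qed.

(** Meant for [z = x_s w / (x_1 x_max(w))] and [i = max(w)]. *)
Lemma exchange_bound i z : exchange d u v -> u ord0 = (v ord0).+1 ->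
    (mdeg z).+1 = d -> z ord0 = v ord0 -> lex_lt (z + U_(i))%MM v ->
  lex_le (U_(ord0) + z)%MM u.
Proof.
move=> hex u0 deg_z z0 lt_zv; rewrite lex_leNgt; apply/negP.
have [y def_u] : exists y, (U_(ord0) + y = u)%MM.
  by exists (u - U_(ord0))%MM; rewrite addmC submK // lepm_mnm1 u0.
have deg_y : (mdeg y).+1 = d by rewrite -deg_u -def_u mdegD mdeg1.
have y0 : y ord0 = v ord0 by move: u0; rewrite -def_u mnmDE mnm1_nat; case.
rewrite -{1}def_u addmC [X in lex_lt _ X]addmC lex_lt_add2r => lt_yz.
(* The last variable is the smallest, so it may replace [x_i]. *)
have lt_zmv : lex_lt (z + U_(ord_max))%MM v.
  apply: lex_le_lt_trans lt_zv; rewrite addmC [X in lex_le _ X]addmC.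
  by rewrite lex_le_add2r lex_leNgt lex_mnm1 -leqNgt -ltnS ltn_ord.
(* If [v < y], then [v < y < z <= z x_i < v] with [x_i] the last variable. *)
have [eq_yv|lt_yv] : y = v \/ lex_lt y v.
  apply: lex_le_eqVlt; rewrite lex_leNgt; apply/negP => lt_vy.
  have := lex_lt_trans lt_vy (lex_lt_le_trans lt_yz (lex_le_addr z U_(ord_max))).
  by move/(lex_lt_trans lt_zmv); rewrite lex_ltxx.
  by move: deg_y; rewrite eq_yv deg_v; exponent_lia.
have [t eq_t lt_t] := lex_ltP _ _ lt_yv.
have t_gt0 : (0 < t)%N.
  by rewrite lt0n; apply/eqP => /(@val_inj _ _ _ t ord0) t0; rewrite t0 y0 ltnn in lt_t.
(* If [x_t] were the last variable, degrees would give [v = y x_t], and [z x_t < v] would contradict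
   [y < z]. *)
have lt_tn : (t < n)%N.
  rewrite ltn_neqAle -ltnS ltn_ord andbT; apply/eqP => tn.
  have def_t : t = ord_max by apply: val_inj.
  suff def_v : (y + U_(t))%MM = v.
    have := lex_lt_trans lt_zmv.
    move/(_ (z + U_(ord_max))%MM); rewrite -{1}def_v def_t.
    by rewrite lex_lt_add2r lex_ltxx => /(_ lt_yz).
  apply: lepm_mdeg_eq; last by rewrite mdegD mdeg1 deg_v -deg_y addn1.
  apply/mnm_lepP => j; rewrite mnmDE mnm1_nat.
  have [/val_inj <-|] := eqVneq (t : nat) j; first by rewrite addn1.
  by rewrite addn0 => neq_tj; rewrite eq_t //; have := ltn_ord j; exponent_lia.
pose p : 'X_{1..n.+1} := [multinom if (i <= t)%N then y i else 0%N | i < n.+1].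
have pE j : p j = if (j <= t)%N then y j else 0%N by rewrite mnmE.
(* The degree lost in truncating [y] to [p]: [p x_e^k] has the degree of [y]. *)
pose k := (d.-1 - mdeg p)%N.
have deg_p : (mdeg p + k).+1 = d.
  have : (mdeg p <= mdeg y)%N.
    by apply: lepm_mdeg; apply/mnm_lepP => j; rewrite pE; case: ifP.
  by rewrite /k; exponent_lia.
have deg_fill e : mdeg (U_(t) + (p + U_(e) *+ k))%MM = d.
  by rewrite !mdegD mdegMn !mdeg1; exponent_lia.
have p0 : p ord0 = v ord0 by rewrite pE.
have p_gt j : (t < j)%N -> p j = 0%N by rewrite ltnNge pE => /negbTE ->.
have p_lt j : (j < t)%N -> p j = v j by move=> lt_jt; rewrite pE ltnW // eq_t.
have le_vr : lex_le v (p + U_(t) *+ k.+1)%MM.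
  apply: (@lex_max _ t); first by rewrite deg_v mdegD mdegMn mdeg1; exponent_lia.
    by move=> j lt_jt; rewrite mnmDE mulmnE mnm1_nat p_lt //; case: eqP; exponent_lia.
  by move=> j lt_tj; rewrite mnmDE mulmnE mnm1_nat p_gt //; case: eqP; exponent_lia.
have lt_fill : (0 < k)%N ->
    lex_lt u (U_(ord0) + (U_(t) + (p + U_(ord_max) *+ k.-1)))%MM.
  move=> _; rewrite -def_u addmC [X in lex_lt _ X]addmC lex_lt_add2r.
  apply/lex_ltP; exists t => [j lt_jt|]; rewrite !(mnmDE, mulmnE, mnm1_nat) /= pE.
    by rewrite ltnW //; do 2?case: eqP; exponent_lia.
  by rewrite leqnn eqxx; exponent_lia.
have le_fill : lex_le (U_(ord0) + (p + U_(ord_max) *+ k))%MM u.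
  rewrite -def_u addmC [X in lex_le _ X]addmC lex_le_add2r.
  apply: (@lex_min _ t.+1); first by rewrite mdegD mdegMn mdeg1; exponent_lia.
    move=> j lt_jt; rewrite !(mnmDE, mulmnE, mnm1_nat) /= pE -ltnS lt_jt.
    by case: eqP; exponent_lia.
  by move=> j ltj; rewrite !(mnmDE, mulmnE, mnm1_nat) /= p_gt;
    [case: eqP; exponent_lia|exponent_lia].
(* If [v] has [x_t]-exponent exactly [y t + 1], the left side is the smallest monomial of degree [d]
   that begins like [v] up to [x_t]. *)
have : lex_le (U_(t) + (p + U_(ord_max) *+ k))%MM v.
  have [lt_t1|eq_t1] := ltnP (y t).+1 (v t).
    apply/lex_ltW/lex_ltP; exists t => [j lt_jt|].
      rewrite !(mnmDE, mulmnE, mnm1_nat) /= p_lt //.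
      by do 2?case: eqP; exponent_lia.
    by rewrite !(mnmDE, mulmnE, mnm1_nat) /= pE leqnn eqxx; case: eqP; exponent_lia.
  apply: (@lex_min _ t.+1); first by rewrite deg_fill.
    move=> j lt_jt; rewrite !(mnmDE, mulmnE, mnm1_nat) /=.
    have [/val_inj <-|neq_tj] := eqVneq (t : nat) j.
      by rewrite pE leqnn; case: eqP; exponent_lia.
    by rewrite p_lt; [case: eqP; exponent_lia|exponent_lia].
  by move=> j ltj; rewrite !(mnmDE, mulmnE, mnm1_nat) /= p_gt;
    [do 2?case: eqP; exponent_lia|exponent_lia].
(* Strict inequality is the first obstruction, with [x_e] the last variable; equality determines
   [v]. *)
case/lex_le_eqVlt => [def_v|lt_v]; last first.
  exact: (@exchange_obstruction _ _ _ _ t ord_max p k hex).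
have v_t : v t = (p t).+1.
  by rewrite -def_v !(mnmDE, mulmnE, mnm1_nat) eqxx /=; case: eqP; exponent_lia.
have v_gt j : (t < j < n)%N -> v j = 0%N.
  move=> ltj; rewrite -def_v !(mnmDE, mulmnE, mnm1_nat) /= p_gt; last exponent_lia.
  by do 2?case: eqP; exponent_lia.
have [f eq_f lt_f] := lex_ltP _ _ lt_yz.
(* If [z] exceeded [y] already at or before [x_t], then [z] times the last variable would reach
   [v]. *)
have lt_tf : (t < f)%N.
  rewrite ltnNge; apply/negP => le_ft.
  suff le_vz : lex_le v (z + U_(ord_max))%MM.
    by rewrite lex_leNgt lt_zmv in le_vz.
  have eq_zv j : (j < f)%N -> v j = (z + U_(ord_max))%MM j.
    move=> lt_jf; rewrite mnmDE mnm1_nat /= -eq_f // -eq_t; last exact: leq_trans le_ft.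
    by case: eqP; exponent_lia.
  have [lt_vf|le_fv] := ltnP (v f) (z f).
    apply/lex_ltW/lex_ltP; exists f => //.
    by rewrite mnmDE (leq_trans lt_vf) ?leq_addr.
  have def_f : f = t.
    apply/val_inj/eqP; rewrite eqn_leq le_ft leqNgt; apply/negP => /eq_t; exponent_lia.
  apply: (@lex_min _ t.+1); first by rewrite mdegD mdeg1 deg_v; exponent_lia.
    move=> j; rewrite ltnS leq_eqVlt => /orP[/eqP/val_inj ->|];
      last by rewrite -def_f; apply: eq_zv.
    rewrite v_t mnmDE mnm1_nat; move: lt_f le_fv; rewrite def_f v_t pE leqnn /=.
    by case: eqP; exponent_lia.
  by move=> j ltj; apply: v_gt.
have z_p j : (j <= t)%N -> z j = p j.
  by move=> le_jt; rewrite pE le_jt eq_f //; apply: leq_ltn_trans lt_tf.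
have k_gt0 : (0 < k)%N.
  suff : (mdeg (p + U_(f))%MM <= mdeg z)%N by rewrite mdegD mdeg1; exponent_lia.
  apply/lepm_mdeg/mnm_lepP => j; rewrite mnmDE mnm1_nat.
  have [/val_inj <-|neq_fj] := eqVneq (f : nat) j; first by rewrite p_gt //; exponent_lia.
  by rewrite addn0; have [le_jt|/p_gt->//] := leqP j t; rewrite z_p.
have [e e_t] : exists e : 'I_n.+1, e = t.+1 :> nat by exists (inord t.+1); rewrite inordK.
(* Since [z] begins with [p], the largest it can be is [p x_e^k] with [x_e] the variable right after
   [x_t]. *)
have lt_ye : lex_lt y (p + U_(e) *+ k)%MM.
  apply: lex_lt_le_trans lt_yz _; apply: (@lex_max _ e).
  - by rewrite mdegD mdegMn mdeg1; exponent_lia.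
  - move=> j lt_je; rewrite !(mnmDE, mulmnE, mnm1_nat) z_p; last exponent_lia.
    by case: eqP; exponent_lia.
  by move=> j lt_ej; rewrite !(mnmDE, mulmnE, mnm1_nat) p_gt;
    [case: eqP; exponent_lia|exponent_lia].
have {lt_ye} lt_ue : lex_lt u (U_(ord0) + (p + U_(e) *+ k))%MM.
  by rewrite -def_u addmC [X in lex_lt _ X]addmC lex_lt_add2r.
case: (pickP [pred j : 'I_n.+1 | (0 < j)%N && (0 < p j)%N]) => [j0 j0P|p_eq0].
  have [s [s_gt0 ps_gt0 s_max]] : exists s : 'I_n.+1,
      [/\ (0 < s)%N, (0 < p s)%N & forall j, (0 < j)%N -> (0 < p j)%N -> (j <= s)%N].
    case: (arg_maxnP (@nat_of_ord n.+1) j0P) => s /andP[s_gt0 ps_gt0] s_max.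
    by exists s; split=> // j j_gt0 pj_gt0; apply: s_max; rewrite /= j_gt0.
  have le_st : (s <= t)%N by rewrite leqNgt; apply/negP => /p_gt; exponent_lia.
  have le_sp : (U_(s) <= p)%MM by rewrite lepm_mnm1.
  have def_p : (U_(s) + (p - U_(s)) = p)%MM by rewrite addmC submK.
  have deg_p' : mdeg p = (mdeg (p - U_(s))%MM).+1.
    by rewrite -{1}def_p mdegD mdeg1.
  (* Second obstruction, with [s], [p / x_s], [k + 1] for [t], [p], [k]. The product [x_s (p / x_s)]
     is [p], so [p x_e^(k+1) < v] follows from [v_t], and the last condition is [lt_ue]. *)
  apply: (@exchange_obstruction _ _ _ _ s e (p - U_(s))%MM k.+1 hex u0 s_gt0).
  - exponent_lia.
  - move=> j lt_sj; rewrite mnmBE; suff -> : p j = 0%N by [].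
    by apply/eqP; rewrite -leqn0 leqNgt; apply/negP => pj; have := s_max j; exponent_lia.
  - by rewrite mnmBE p0 mnm1_nat /=; case: eqP; exponent_lia.
  - exponent_lia.
  - apply: (@lex_max _ s); first by rewrite deg_v mdegD mdegMn mdeg1; exponent_lia.
      move=> j lt_js; rewrite !(mnmDE, mnmBE, mulmnE, mnm1_nat) p_lt; last exponent_lia.
      by case: eqP; exponent_lia.
    move=> j lt_sj; rewrite !(mnmDE, mnmBE, mulmnE, mnm1_nat).
    suff -> : p j = 0%N by case: eqP; exponent_lia.
    by apply/eqP; rewrite -leqn0 leqNgt; apply/negP => pj; have := s_max j; exponent_lia.
  - rewrite addmA def_p; apply/lex_ltP; exists t => [j lt_jt|].
      by rewrite !(mnmDE, mulmnE, mnm1_nat) p_lt //; case: eqP; exponent_lia.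
    by rewrite !(mnmDE, mulmnE, mnm1_nat) v_t; case: eqP; exponent_lia.
  - rewrite -def_u addmC [X in lex_le _ X]addmC lex_le_add2r.
    apply/lex_ltW/lex_ltP; exists s => [j lt_js|];
      rewrite !(mnmDE, mnmBE, mulmnE, mnm1_nat) pE.
      by rewrite (leq_trans (ltnW lt_js) le_st); case: eqP; case: eqP; exponent_lia.
    by move: ps_gt0; rewrite pE le_st eqxx; case: eqP; exponent_lia.
  by move=> _; rewrite /= [(U_(s) + _)%MM]addmA def_p.
have {}p_eq0 j : (0 < j)%N -> p j = 0%N.
  by have := p_eq0 j => /=; case: (p j) => // q; case: (0 < j)%N.
(* Here [p] is a power of [x_1], so the only quotients of degree [d] are [p x_e^(k+1)], below [v],
   and [x_1 p x_e^k], above [u]. *)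
have [|||j [w [/lexsegP[_ le_wu le_vw] def_w]]] :=
    @shadow_between (U_(ord0) + (p + U_(e) *+ k.+1))%MM.
- by rewrite !mdegD mdegMn !mdeg1; exponent_lia.
- apply/lex_ltW/lex_lt0; rewrite !(mnmDE, mulmnE, mnm1_nat) p0 /=.
  by case: eqP; exponent_lia.
- apply/lex_ltW/lex_lt0; rewrite !(mnmDE, mulmnE, mnm1_nat) p0 u0 /=.
  by case: eqP; exponent_lia.
have [j0|j_neq0] := eqVneq j ord0.
  move: def_w le_vw; rewrite j0 => /addmI <-; rewrite lex_leNgt => /negP; apply.
  apply/lex_ltP; exists t => [l lt_lt|].
    by rewrite !(mnmDE, mulmnE, mnm1_nat) p_lt //; case: eqP; exponent_lia.
  by rewrite !(mnmDE, mulmnE, mnm1_nat) v_t; case: eqP; exponent_lia.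
have j_e : j = e.
  have := congr1 (fun m : 'X_{1..n.+1} => m j) def_w.
  rewrite !(mnmDE, mulmnE, mnm1_nat) p_eq0 ?lt0n // eqxx.
  have : (j : nat) != 0%N by [].
  by case: (eqVneq (e : nat) j) => [/val_inj ->//|] /=; exponent_lia.
move: le_wu; rewrite lex_leNgt; suff -> : w = (U_(ord0) + (p + U_(e) *+ k))%MM.
  by rewrite lt_ue.
apply: (@addmI _ U_(e)%MM); rewrite -{1}j_e -def_w mulmS.
by apply/mnmP => l; rewrite !mnmDE; exponent_lia.
Qed.

End CompletelyLexsegment.

(** * Positions in the enumeration, and the last variable of a monomial *)

Section PrecEnumeration.
Variable n : nat.
Implicit Types (m w r : 'X_{1..n.+1}) (ws : seq 'X_{1..n.+1}).

Lemma prec_trans : transitive (@prec n).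
Proof.
move=> y x z; rewrite /prec => /orP[lt_xy|/andP[/eqP eq_xy lt_yx]];
  move=> /orP[lt_yz|/andP[/eqP eq_yz lt_zy]]; apply/orP; [left|left|left|right].
- exact: ltn_trans lt_yz.
- by rewrite -eq_yz.
- by rewrite eq_xy.
- by rewrite eq_xy eq_yz eqxx (lex_lt_trans lt_zy).
Qed.

Lemma prec_index ws w r : sorted (@prec n) ws -> w \in ws -> r \in ws ->
  prec r w = (index r ws < index w ws)%N.
Proof.
move=> ws_sorted w_in r_in; apply/idP/idP => [pr|]; last first.
  exact: (sorted_ltn_index prec_trans).
rewrite ltnNge leq_eqVlt; apply/negP => /orP[/eqP eq_wr|].
  by move: pr; rewrite -(nth_index w w_in) eq_wr nth_index // prec_irr.
move/(sorted_ltn_index prec_trans ws_sorted) => /(_ w_in r_in)/(prec_trans pr).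
by rewrite prec_irr.
Qed.

Lemma mem_take_prec ws w r : sorted (@prec n) ws -> w \in ws ->
  (r \in take (index w ws) ws) = (r \in ws) && prec r w.
Proof.
move=> ws_sorted w_in; have [r_in|r_notin] := boolP (r \in ws).
  by rewrite in_take // (prec_index ws_sorted).
by apply/negP => /mem_take; apply/negP.
Qed.

Lemma max_varP m : m != 0%MM ->
  (0 < m (max_var m))%N /\ forall i, (0 < m i)%N -> (i <= max_var m)%N.
Proof.
rewrite -mdeg_eq0 mdegE sum_nat_eq0 negb_forall => /existsP[j mj].
have [|i m_i max_i] := @eq_bigmax_cond _ [pred i | (U_(i) <= m)%MM] (@nat_of_ord n.+1).
  by apply/card_gt0P; exists j; rewrite inE lepm_mnm1 lt0n.
rewrite /max_var max_i inord_val; split; first by rewrite -lepm_mnm1.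
by move=> l ml; rewrite -max_i leq_bigmax_cond // inE lepm_mnm1.
Qed.

End PrecEnumeration.

(** * Linear quotients and the decomposition function in terms of divisibility *)

Section LinearQuotients.
Variables (n : nat) (k : fieldType).
Implicit Types (m w r : 'X_{1..n.+1}) (ws : seq 'X_{1..n.+1}).
Local Open Scope ring_scope.

Lemma mem_mon_ideal ws m :
  mon_ideal (k := k) ws 'X_[m] <-> exists2 w, w \in ws & (w <= m)%MM.
Proof. exact: (mem_monomial_ideal k (fun w => w \in ws)). Qed.

Lemma lq_setP ws w s :
  lq_set k ws w s <->
  exists2 w', w' \in take (index w ws) ws & (w' <= U_(s) + w)%MM.
Proof. by rewrite /lq_set /colon_before /colon -mpolyXD; apply: mem_mon_ideal. Qed.

(** Truncated subtraction makes [r - w] the monomial [r / gcd(r, w)]. It lies in the colon ideal, so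
    a variable [x_i] of that ideal divides it, and an earlier generator divides [x_i w]. *)
Lemma linear_quotients_exchange d u v ws :
  prec_enum d u v ws -> linear_quotients k ws -> exchange d u v.
Proof.
move=> [ws_sorted wsE] hlin w r; rewrite -!wsE => w_in r_in pr.
have r_take : r \in take (index w ws) ws by rewrite mem_take_prec ?r_in.
have [|A defA] := hlin (index w ws).
  by rewrite index_mem w_in andbT (leq_ltn_trans _ (index_ltn r_take)).
rewrite nth_index // in defA.
have /defA[c [genA def_rw]] : colon_before (k := k) ws w 'X_[r - w].
  rewrite /colon_before /colon -mpolyXD; apply/mem_mon_ideal; exists r => //.
  by apply/mnm_lepP => i; rewrite mnmDE mnmBE addnC -leq_subLR.
have [|_ [i iA ->] le_i] :=
    (mem_monomial_ideal k (fun m => exists2 i, i \in A & m = U_(i)%MM) (r - w)%MM).1.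
  exists c; split=> // e /genA[i iA def_e].
  by exists U_(i)%MM => //; exists i.
have /lq_setP[w' w'_take le_w'] : lq_set k ws w i.
  apply/defA; exists [:: (1, 'X_i)]; split=> [e|]; last by rewrite big_seq1 mul1r.
  by rewrite inE => /eqP ->; exists i.
exists i, w'; move: w'_take; rewrite mem_take_prec // wsE => /andP[Lw' pw'].
by split=> //; move: le_i; rewrite lepm_mnm1 mnmBE subn_gt0.
Qed.

(** The index chosen by [g] is that of the first generator dividing [m], hence of the [prec]-least
    one. *)
Lemma decomposition_eq d u v ws g m w :
    prec_enum d u v ws -> decomposition_function k ws g ->
    lexseg d u v w -> (w <= m)%MM ->
    (forall r, lexseg d u v r -> (r <= m)%MM -> r != w -> prec w r) ->
  g m = w.
Proof.
move=> [ws_sorted wsE] hg; rewrite -wsE => w_in le_wm w_min.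
have [|j [lt_j -> ]] := hg m; first by apply/mem_mon_ideal; exists w.
case/mem_mon_ideal => r r_take le_rm j_min.
have r_in := mem_take r_take.
have index_ge r' : r' \in ws -> (r' <= m)%MM -> (j <= index r' ws)%N.
  move=> r'_in le_r'm; rewrite leqNgt; apply/negP => /j_min; apply.
  by apply/mem_mon_ideal; exists r'; rewrite ?in_take.
have def_j : j = index r ws.
  by apply/eqP; rewrite eqn_leq index_ge //= -ltnS; move: r_take; rewrite in_take.
rewrite def_j nth_index //; apply/eqP/negPn/negP => neq_rw.
have := w_min r; rewrite -wsE => /(_ r_in le_rm neq_rw).
by rewrite (prec_index ws_sorted) // ltnNge -def_j index_ge.
Qed.

End LinearQuotients.

(** * The formula for [g] *)

Theorem lemma2p1p5 (n : nat) (k : fieldType) (d : nat) (hd : (2 <= d)%N)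
    (u v : 'X_{1..n.+1}) (hu : mdeg u = d) (hv : mdeg v = d)
    (huv : lex_le v u)
    (ws : seq 'X_{1..n.+1}) (hws : prec_enum d u v ws)
    (hcomplete : completely_lexseg (fun w => lexseg d u v w))
    (hlin : linear_quotients k ws)
    (g : 'X_{1..n.+1} -> 'X_{1..n.+1}) (hg : decomposition_function k ws g)
    (w : 'X_{1..n.+1}) (hw : lexseg d u v w)
    (s : 'I_n.+1) (hs : lq_set k ws w s) :
  g (U_(s) + w)%MM =
    if lex_le (U_(ord0) + v)%MM (U_(s) + w)%MM
    then (U_(s) + w - U_(ord0))%MM
    else (U_(s) + w - U_(max_var w))%MM.
Proof.
have [deg_w le_wu le_vw] := lexsegP _ _ _ _ hw.
set m := (U_(s) + w)%MM.
have deg_m : mdeg m = d.+1 by rewrite mdegD mdeg1 deg_w.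
have quotient_deg i : (0 < m i)%N -> mdeg (m - U_(i))%MM = d.
  rewrite -lepm_mnm1 => le_im; apply: succn_inj.
  by rewrite -deg_m -{2}(submK le_im) mdegD mdeg1 addn1.
have divisorP r : lexseg d u v r -> (r <= m)%MM ->
    exists2 i, (0 < m i)%N & r = (m - U_(i))%MM.
  by move=> /lexsegP[deg_r _ _] le_rm; apply: lepm_mdegS; rewrite ?deg_r.
have lex_le_sub i r : (0 < m i)%N -> lex_le (U_(i) + r)%MM m = lex_le r (m - U_(i))%MM.
  by rewrite -lepm_mnm1 => le_im; rewrite -{1}(submK le_im) addmC lex_le_add2r.
case: ifPn => [le_vm|]; last rewrite lex_leNgt negbK => lt_mv.
  have m0_gt0 : (0 < m ord0)%N.
    have := lex_le0 le_vm; rewrite [X in (X <= _)%N -> _]mnmDE mnm1_nat.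
    exact: leq_trans.
  (* Only division by [x_1] lowers the [x_1]-exponent, so [m / x_1] precedes every other
     quotient. *)
  apply: (decomposition_eq hws hg); last 1 first.
  - move=> r Lr le_rm; have [i m_i ->] := divisorP r Lr le_rm.
    have [->|neq_i0 _] := eqVneq i ord0; first by rewrite eqxx.
    rewrite /prec !mnmBE !mnm1_nat eqxx subn1 /=.
    by rewrite (negbTE (neq_i0 : (i : nat) != 0%N)) subn0 ltn_predL m0_gt0.
  - apply/lexsegP; split; first exact: quotient_deg.
      rewrite -(lex_le_add2r U_(ord0)%MM) submK ?lepm_mnm1 //.
      apply: (@lex_le_trans _ _ (U_(ord0) + w)%MM); last by rewrite addmC lex_le_add2r.
      by rewrite lex_le_add2r lex_leNgt lex_mnm1.
    by rewrite -lex_le_sub.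
  - exact: lem_subr.
have [_ wsE] := hws.
(* The generator [r = m / x_j] before [w], given by [s] in [set(w)], serves to show that
   [s < max(w)]. *)
have /lq_setP[r] := hs; rewrite mem_take_prec ?wsE ?hws.1 // => /andP[Lr pr] le_rm.
have [j m_j def_r] := divisorP r Lr le_rm.
have [_ _ le_vr] := lexsegP _ _ _ _ Lr.
have j_gt0 : (0 < j)%N.
  rewrite lt0n; apply/eqP => /(@val_inj _ _ _ j ord0) j0.
  by move: le_vr; rewrite def_r j0 -lex_le_sub -?j0 // j0 lex_leNgt lt_mv.
have r0 : r ord0 = m ord0 by rewrite def_r mnmBE mnm1_nat eqn0Ngt j_gt0 subn0.
have s_gt0 : (0 < s)%N.
  rewrite lt0n; apply/eqP => s0; move: pr; rewrite /prec r0 mnmDE mnm1_nat s0 /=.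
  by rewrite add1n ltnNge leqnSn /= eq_sym eqn_leq ltnn andbF.
have m0 : m ord0 = w ord0 by rewrite mnmDE mnm1_nat eqn0Ngt s_gt0.
have lt_wr : lex_lt w r by move: pr; rewrite /prec r0 m0 ltnn eqxx.
have lt_sj : (s < j)%N.
  move: lt_wr; rewrite -(lex_lt_add2r U_(j)%MM) def_r submK ?lepm_mnm1 //.
  by rewrite /m addmC lex_lt_add2r lex_mnm1.
have [|w_max le_max] := @max_varP _ w; first by rewrite -mdeg_eq0 deg_w -lt0n ltnW.
set x := max_var w in w_max le_max *.
have lt_sx : (s < x)%N.
  apply: (leq_trans lt_sj (le_max j _)); move: m_j.
  by rewrite mnmDE mnm1_nat (ltn_eqF lt_sj).
have m_x : (0 < m x)%N by rewrite mnmDE addn_gt0 w_max orbT.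
have x_gt0 : (0 < x)%N by apply: leq_trans lt_sx.
have mx0 : (m - U_(x))%MM ord0 = w ord0.
  by rewrite mnmBE mnm1_nat eqn0Ngt x_gt0 subn0.
have le_mu : lex_le (m - U_(x))%MM u.
  rewrite lex_leNgt; apply/negP => lt_umx.
  have u0 : u ord0 = w ord0.
    by apply/eqP; rewrite eqn_leq (lex_le0 le_wu) -mx0 (lex_le0 (lex_ltW lt_umx)).
  have shad_seg : is_lexseg (shadow (fun w => lexseg d u v w)) := hcomplete 1%N.
  (* From [v <= w] and [m < x_1 v], the [x_1]-exponent of [w] is that of [v] or one more. *)
  have := lex_le0 (lex_ltW lt_mv); rewrite m0 mnmDE mnm1_nat /= add1n.
  have := lex_le0 le_vw; rewrite leq_eqVlt => /orP[/eqP v0 _|lt_v0 le_v0].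
    suff : lex_le (m - U_(x))%MM u by rewrite lex_leNgt lt_umx.
    apply: (shadow_bound hu hv huv shad_seg); first by rewrite u0 v0.
    - by have := ltn_ord x; exponent_lia.
    - exact: quotient_deg.
    by rewrite mx0.
  have u0v : u ord0 = (v ord0).+1 by rewrite u0; apply/eqP; rewrite eqn_leq le_v0.
  have [y def_y] : exists y, (U_(ord0) + y = m - U_(x))%MM.
    exists (m - U_(x) - U_(ord0))%MM; rewrite addmC submK // lepm_mnm1 mx0 -u0 u0v //.
  suff : lex_le (U_(ord0) + y)%MM u by rewrite lex_leNgt def_y lt_umx.
  apply: (@exchange_bound _ d u v hu hv huv shad_seg x) => //.
  - exact: linear_quotients_exchange hws hlin.
  - by have := quotient_deg _ m_x; rewrite -def_y mdegD mdeg1.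
  - by move: mx0; rewrite -def_y mnmDE mnm1_nat -u0 u0v; case.
  - rewrite -(lex_lt_add2r U_(ord0)%MM) addmC addmA def_y submK ?lepm_mnm1 //.
    by rewrite [(v + _)%MM]addmC.
(* Now [m / x_1] is below [v], so all competitors share the [x_1]-exponent of [m], and removing the
   last variable leaves the lexicographically largest quotient. *)
apply: (decomposition_eq hws hg); last 1 first.
- move=> r' Lr' le_r'm; have [i m_i def_r'] := divisorP r' Lr' le_r'm.
  rewrite def_r' => neq_r'.
  have i_gt0 : (0 < i)%N.
    rewrite lt0n; apply/eqP => /(@val_inj _ _ _ i ord0) i0.
    have [_ _] := lexsegP _ _ _ _ Lr'.
    by rewrite def_r' i0 -lex_le_sub -?i0 // i0 lex_leNgt lt_mv.
  rewrite /prec mx0 mnmBE m0 mnm1_nat eqn0Ngt i_gt0 subn0 ltnn eqxx /=.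
  have lt_ix : (i < x)%N.
    rewrite ltn_neqAle; apply/andP; split.
      by apply: contraNneq neq_r' => /val_inj ->.
    move: m_i; rewrite mnmDE mnm1_nat; case: eqP => [<- _|_]; first exact: ltnW.
    exact: le_max.
  rewrite -(lex_lt_add2r (U_(i) + U_(x))%MM) addmA submK ?lepm_mnm1 //.
  rewrite [(U_(i) + _)%MM]addmC addmA submK ?lepm_mnm1 // addmC.
  by rewrite [X in lex_lt _ X]addmC lex_lt_add2r lex_mnm1.
- apply/lexsegP; split; [exact: quotient_deg|exact: le_mu|].
  (* As [s < max(w)], replacing [x_max(w)] by [x_s] can only enlarge [w]. *)
  apply: lex_le_trans le_vw _; rewrite -lex_le_sub // lex_le_add2r.
  by rewrite lex_leNgt lex_mnm1 -leqNgt ltnW.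
- exact: lem_subr.
Qed.
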